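(* Let $r,s$ be positive integers, let $a_1,\dots,a_r,b_1,\dots,b_s,\alpha,\beta,z$ be as in the context, and let $w\in\mathbb{C}$ be the transform variable. Then the $q$-Laplace transform of the ${}_rR_{s,q}$ function is given by $$\mathfrak{L}_q\left[t^{\beta-1}\,{}_rR_{s,q}(a_1,\dots,a_r;b_1,\dots,b_s;\alpha,\beta;zt^\alpha);w\right]=w^{-\beta}(1-q)^{\beta-1}\,{}_r\Phi_s\left(a_1,\dots,a_r;b_1,\dots,b_s;z(1-q)^\alpha w^{-\alpha}\right).$$
   Context: Let $q\in\mathbb{C}$, $0<|q|<1$; complex powers are formed with fixed branches. $(a;q)_0=1$, $(a;q)_n=\prod_{i=0}^{n-1}(1-aq^i)$ for $n\ge1$, $(a;q)_\infty=\prod_{i\ge0}(1-aq^i)$. $\Gamma_q(x)=\frac{(q;q)_\infty}{(q^x;q)_\infty}(1-q)^{1-x}$, with $1/\Gamma_q(x)$ read as $0$ at its poles. For complex parameters the basic function ${}_rR_{s,q}$ and the basic hypergeometric function ${}_r\Phi_s$ are $${}_rR_{s,q}(a_1,\dots,a_r;b_1,\dots,b_s;\alpha,\beta;z)=\sum_{\ell=0}^\infty\frac{z^\ell(-1)^{(1+s-r)\ell}q^{(1+s-r)\binom{\ell}{2}}}{(q;q)_\ell\,\Gamma_q(\ell\alpha+\beta)}\,\frac{\prod_{i=1}^r(a_i;q)_\ell}{\prod_{j=1}^s(b_j;q)_\ell},$$ $${}_r\Phi_s(a_1,\dots,a_r;b_1,\dots,b_s;z)=\sum_{\ell=0}^\infty\frac{z^\ell}{(q;q)_\ell}\frac{\prod_{i=1}^r(a_i;q)_\ell}{\prod_{j=1}^s(b_j;q)_\ell}\left[(-1)^\ell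 q^{\binom{\ell}{2}}\right]^{1+s-r}.$$ Standing assumption: $a_iq^\ell\ne1$ and $b_jq^\ell\neq1$ for all $i,j$ and all integers $\ell\ge0$. The Jackson integral is $\int_0^xf(t)\,\mathrm{d}_qt=(1-q)x\sum_{n\ge0}q^nf(xq^n)$. The $q$-Laplace transform is $$\mathfrak{L}_q[f(t);w]=\frac1{1-q}\int_0^{1/w}(qwt;q)_\infty\,f(t)\,\mathrm{d}_qt\qquad(w\in\mathbb{C}).$$
   Formalization: Adds |q^α|≤1 and |q^β|<1 (the claim fails e.g. for α=1, β=0, where 1/Γ_q(0)=0 kills the ℓ=0 term), plus w≠0, convergence of the Φ series, and branches with t^x=q^{nx}w^{-x} at t=q^n/w. *)

(* Defs.v *)
(* Stdlib reals with Coquelicot's complex numbers. *)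
From Stdlib Require Import Reals ZArith Lra Lia.
From Coquelicot Require Import Coquelicot.
Open Scope C_scope.

Definition Cexp (z : C) : C :=
  (exp (Re z) * cos (Im z), exp (Re z) * sin (Im z))%R.

(* The power b^x formed with the determination l of log b (so Cexp l = b). *)
Definition cpower (l x : C) : C := Cexp (x * l).

Definition Cpowz (z : C) (k : Z) : C :=
  match k with
  | Z0 => 1
  | Zpos p => z ^ Pos.to_nat p
  | Zneg p => / (z ^ Pos.to_nat p)
  end.

Fixpoint Cprod (n : nat) (f : nat -> C) : C :=
  match n with
  | O => 1
  | S m => Cprod m f * f m
  end.

(* Limits and sums are taken on real and imaginary parts, as in Coquelicot's
   C_lim; they are meaningful only for convergent arguments. *)
Definition C_lim_seq (u : nat -> C) : C :=
  (real (Lim_seq (fun n => Re (u n))), real (Lim_seq (fun n => Im (u n)))).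

Definition CSeries (u : nat -> C) : C :=
  (Series (fun n => Re (u n)), Series (fun n => Im (u n))).

Definition ex_Cseries (u : nat -> C) : Prop :=
  ex_series (V := C_R_NormedModule) u.

Lemma C_lim_seq_unique (u : nat -> C) (l : C) :
  filterlim u eventually (locally (T := C_R_NormedModule) l) -> C_lim_seq u = l.
Proof.
  intros H; destruct l as [a b]; unfold C_lim_seq.
  assert (Ha : is_lim_seq (fun n => Re (u n)) a).
  { unfold is_lim_seq, Rbar_locally.
    intros P [e He]; apply (H (fun y : C => P (Re y))).
    exists e; intros y [Hy _]; apply He, Hy. }
  assert (Hb : is_lim_seq (fun n => Im (u n)) b).
  { unfold is_lim_seq, Rbar_locally.
    intros P [e He]; apply (H (fun y : C => P (Im y))).
    exists e; intros y [_ Hy]; apply He, Hy. }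
  now rewrite (is_lim_seq_unique _ _ Ha), (is_lim_seq_unique _ _ Hb).
Qed.

Lemma CSeries_unique (u : nat -> C) (l : C) :
  is_series (V := C_R_NormedModule) u l -> CSeries u = l.
Proof.
  intros H; rewrite <- (C_lim_seq_unique _ _ H).
  unfold CSeries, C_lim_seq, Series.
  assert (E1 : forall n, sum_n (fun k => Re (u k)) n =
                         Re (sum_n (G := C_R_NormedModule) u n)).
  { induction n as [|n IH]; [now rewrite !sum_O|].
    rewrite !sum_Sn, IH; reflexivity. }
  assert (E2 : forall n, sum_n (fun k => Im (u k)) n =
                         Im (sum_n (G := C_R_NormedModule) u n)).
  { induction n as [|n IH]; [now rewrite !sum_O|].
    rewrite !sum_Sn, IH; reflexivity. }
  now rewrite (Lim_seq_ext _ _ E1), (Lim_seq_ext _ _ E2).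
Qed.

Definition qpoch (a q : C) (n : nat) : C := Cprod n (fun i => 1 - a * q ^ i).

Definition qpoch_inf (a q : C) : C := C_lim_seq (qpoch a q).

(* lq and l1q are the chosen determinations of log q and log (1 - q). *)
Definition qGamma (q lq l1q x : C) : C :=
  qpoch_inf q q / qpoch_inf (cpower lq x) q * cpower l1q (1 - x).

Definition inv_qGamma (q lq l1q x : C) : C :=
  if Ceq_dec (qpoch_inf (cpower lq x) q) 0 then 0 else / qGamma q lq l1q x.

Definition binom2 (l : nat) : nat := Nat.div (l * (l - 1)) 2.

(* The parameters a_1, ..., a_r and b_1, ..., b_s are a 0, ..., a (r - 1) and
   b 0, ..., b (s - 1); further values of a and b are irrelevant. *)
Definition qpoch_ratio (q : C) (r s : nat) (a b : nat -> C) (l : nat) : C :=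
  Cprod r (fun i => qpoch (a i) q l) / Cprod s (fun j => qpoch (b j) q l).

Definition excess (r s : nat) : Z := (1 + Z.of_nat s - Z.of_nat r)%Z.

Definition basicR_term (q lq l1q : C) (r s : nat) (a b : nat -> C)
    (alpha beta z : C) (l : nat) : C :=
  z ^ l * Cpowz (-1) (excess r s * Z.of_nat l)
    * Cpowz q (excess r s * Z.of_nat (binom2 l)) / qpoch q q l
  * inv_qGamma q lq l1q (INR l * alpha + beta)
  * qpoch_ratio q r s a b l.

Definition basicR (q lq l1q : C) (r s : nat) (a b : nat -> C)
    (alpha beta z : C) : C :=
  CSeries (basicR_term q lq l1q r s a b alpha beta z).

Definition basicPhi_term (q : C) (r s : nat) (a b : nat -> C) (z : C)
    (l : nat) : C :=
  z ^ l / qpoch q q l * qpoch_ratio q r s a b l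
  * Cpowz ((-1) ^ l * q ^ binom2 l) (excess r s).

Definition basicPhi (q : C) (r s : nat) (a b : nat -> C) (z : C) : C :=
  CSeries (basicPhi_term q r s a b z).

Definition jackson_term (q : C) (f : C -> C) (x : C) (n : nat) : C :=
  q ^ n * f (x * q ^ n).

Definition ex_jackson (q : C) (f : C -> C) (x : C) : Prop :=
  ex_Cseries (jackson_term q f x).

Definition jackson (q : C) (f : C -> C) (x : C) : C :=
  (1 - q) * x * CSeries (jackson_term q f x).

Definition qLaplace_kernel (q : C) (f : C -> C) (w t : C) : C :=
  qpoch_inf (q * w * t) q * f t.

Definition ex_qLaplace (q : C) (f : C -> C) (w : C) : Prop :=
  ex_jackson q (qLaplace_kernel q f w) (1 / w).

Definition qLaplace (q : C) (f : C -> C) (w : C) : C :=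
  1 / (1 - q) * jackson q (qLaplace_kernel q f w) (1 / w).

(* logt is a branch of the logarithm in the variable t, used to form t^x.  The
   q-Laplace transform at w samples t only on the grid q^n / w, where the branch
   must be the one for which t^x = q^(n x) w^(-x), the powers of q and w being
   formed with lq and lw.  (For q in (0,1) and w off the negative real axis,
   the principal logarithm in all three variables qualifies.) *)
Definition compatible_branch (q lq w lw : C) (logt : C -> C) : Prop :=
  (forall t : C, t <> 0 -> Cexp (logt t) = t) /\
  (forall n : nat, logt (1 / w * q ^ n) = INR n * lq - lw).

(* Main.v *)
Require Import Defs.
From Stdlib Require Import Reals ZArith Lra Lia.
From Coquelicot Require Import Coquelicot.
Open Scope C_scope.

(** The transform of a single power is Euler's identity: for [|x| < 1],
    the sum over [n] of [x ^ n * (q ^ (n + 1); q)_inf] is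
    [(q; q)_inf / (x; q)_inf] ([euler_tails]).  With [x = q ^ (l alpha + beta)]
    the right-hand side is, up to a power of [1 - q], Gamma_q at
    [l alpha + beta], which cancels the 1 / Gamma_q in the [l]-th term of R and
    leaves the [l]-th term of Phi ([basicR_term_grid]).  So the theorem
    is an exchange of the sum over the Jackson grid with the sum over [l].

    Euler's identity follows from the functional equation
    [E (x q) = (1 - x) E x] of the series [E x] of the [x ^ n / (q; q)_n]:
    iterating it gives [(x; q)_N * E x = E (x q ^ N)], which tends to [E 0 = 1],
    so that [(x; q)_inf = 1 / E x].

    The exchange ([CSeries_exchange]) needs a bound [x_n * y_l] with both series
    convergent.  The factor in [n] is geometric of ratio [|q ^ beta| < 1], times
    bounded infinite products.  The factor in [l] is the modulus of the Phi term,
    so the Phi series, only known to converge, must be shown to converge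
    absolutely ([basicPhi_abs]).  When [|q ^ alpha| = 1] the powers
    [q ^ (l alpha)] may oscillate, and conditional convergence would not be
    enough.  Absolute convergence holds because every
    [(a; q)_l] lies between two positive constants: the moduli of the terms are
    comparable to [|z| ^ l * p ^ (l (l - 1) / 2)] with [p = |q| ^ (1 + s - r)],
    and such a sequence is summable as soon as it tends to [0]. *)

(** * Dominated double series of reals *)

Lemma ex_series_Rabs_le (a b : nat -> R) :
  (forall n, (Rabs (a n) <= b n)%R) -> ex_series b -> ex_series a.
Proof.
  intros H; apply (ex_series_le (V := R_CompleteNormedModule)), H.
Qed.

Lemma Rabs_Series_le (a b : nat -> R) :
  (forall n, (Rabs (a n) <= b n)%R) -> ex_series b ->
  (Rabs (Series a) <= Series b)%R.
Proof.
  intros H Hb.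
  assert (Ha : ex_series (fun n => Rabs (a n))).
  { apply ex_series_Rabs_le with b; [intros n; rewrite Rabs_Rabsolu; apply H | easy]. }
  eapply Rle_trans; [now apply Series_Rabs|].
  apply Series_le; [|easy].
  intros n; split; [apply Rabs_pos | apply H].
Qed.

Lemma Series_tail (a : nat -> R) (L : nat) :
  ex_series a ->
  (Series a - sum_n a L = Series (fun k => a (S L + k)%nat))%R.
Proof.
  intros Ha; rewrite sum_n_Reals, (Series_incr_n a (S L)); [simpl; lra | lia | easy].
Qed.

Lemma Series_tail_le (a b : nat -> R) (L : nat) :
  (forall n, (Rabs (a n) <= b n)%R) -> ex_series b ->
  (Rabs (Series a - sum_n a L) <= Series b - sum_n b L)%R.
Proof.
  intros H Hb.
  rewrite !Series_tail; [|easy|now apply ex_series_Rabs_le with b].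
  apply Rabs_Series_le; [intros k; apply H | now apply (ex_series_incr_n b (S L))].
Qed.

(** The partial sums of the column sums are sums of truncated rows, and the
    tail of row [n] is at most [x n] times the tail of [y]. *)
Lemma Series_exchange (F : nat -> nat -> R) (x y : nat -> R) :
  (forall n l, (Rabs (F n l) <= x n * y l)%R) -> ex_series x -> ex_series y ->
  ex_series (fun n => Series (F n)) /\
  is_series (fun l => Series (fun n => F n l)) (Series (fun n => Series (F n))).
Proof.
  intros HF Hx Hy.
  assert (Hxy : forall n, ex_series (fun l => (x n * y l)%R)).
  { intros n; now apply (ex_series_scal (V := R_NormedModule) (x n)). }
  assert (Hyx : forall c : R, ex_series (fun n => (x n * c)%R)).
  { intros c; now apply ex_series_scal_r. }
  assert (Hrow : forall n, ex_series (F n)).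
  { intros n; apply ex_series_Rabs_le with (2 := Hxy n), HF. }
  assert (Hcol : forall l, ex_series (fun n => F n l)).
  { intros l; apply ex_series_Rabs_le with (2 := Hyx (y l)); intros n; apply HF. }
  assert (HR : ex_series (fun n => Series (F n))).
  { apply ex_series_Rabs_le with (2 := Hyx (Series y)); intros n.
    rewrite <- Series_scal_l; now apply Rabs_Series_le. }
  split; [exact HR|].
  assert (Htr : forall L, ex_series (fun n => sum_n (F n) L) /\
    sum_n (fun l => Series (fun n => F n l)) L = Series (fun n => sum_n (F n) L)).
  { induction L as [|L [IHe IH]].
    - split.
      + apply ex_series_ext with (2 := Hcol O); intros n; now rewrite sum_O.
      + rewrite sum_O; apply Series_ext; intros n; now rewrite sum_O.
    - split.
      + apply ex_series_ext with (fun n => (sum_n (F n) L + F n (S L))%R);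
          [intros n; now rewrite sum_Sn|].
        apply (ex_series_plus (V := R_NormedModule)); easy.
      + rewrite sum_Sn, IH; unfold plus; simpl; rewrite <- Series_plus; try easy.
        apply Series_ext; intros n; now rewrite sum_Sn. }
  change (is_lim_seq (sum_n (fun l => Series (fun n => F n l)))
                     (Series (fun n => Series (F n)))).
  apply (is_lim_seq_ext
    (fun L => Series (fun n => Series (F n))
              - (Series (fun n => Series (F n)) - sum_n (fun l => Series (fun n => F n l)) L))%R);
    [intros L; ring|].
  replace (Finite (Series (fun n => Series (F n))))
    with (Finite (Series (fun n => Series (F n)) - 0)) by (f_equal; ring).
  apply is_lim_seq_minus'; [apply is_lim_seq_const|].
  apply is_lim_seq_abs_0.
  apply is_lim_seq_le_le with (fun _ => 0%R)
    (fun L => (Series x * (Series y - sum_n y L))%R).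
  - intros L; split; [apply Rabs_pos|].
    destruct (Htr L) as [He ->].
    rewrite <- Series_minus, <- Series_scal_r by easy.
    apply Rabs_Series_le; [|apply Hyx]; intros n.
    replace (x n * (Series y - sum_n y L))%R
      with (Series (fun l => x n * y l) - sum_n (fun l => x n * y l) L)%R.
    + apply Series_tail_le; [apply HF | apply Hxy].
    + rewrite Series_scal_l.
      replace (sum_n (fun l => x n * y l)%R L) with (x n * sum_n y L)%R; [ring|].
      symmetry; exact (sum_n_mult_l (K := R_Ring) (x n) y L).
  - apply is_lim_seq_const.
  - replace (Finite 0) with (Finite (Series x * (Series y - Series y))) by (f_equal; ring).
    apply is_lim_seq_mult'; [apply is_lim_seq_const|].
    apply is_lim_seq_minus'; [apply is_lim_seq_const|].
    now apply Series_correct.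
Qed.

(** * Complex series *)

Lemma is_Cseries_comp (u : nat -> C) (l : C) :
  is_series (V := C_R_NormedModule) u l <->
  is_series (fun n => Re (u n)) (Re l) /\ is_series (fun n => Im (u n)) (Im l).
Proof.
  assert (ER : forall n, sum_n (fun k => Re (u k)) n =
                         Re (sum_n (G := C_R_NormedModule) u n)).
  { induction n as [|n IH]; [now rewrite !sum_O|].
    rewrite !sum_Sn, IH; reflexivity. }
  assert (EI : forall n, sum_n (fun k => Im (u k)) n =
                         Im (sum_n (G := C_R_NormedModule) u n)).
  { induction n as [|n IH]; [now rewrite !sum_O|].
    rewrite !sum_Sn, IH; reflexivity. }
  split.
  - intros H; split; intros P [e He].
    + destruct (H (fun y : C => P (Re y))) as [N HN].
      { exists e; intros y [Hy _]; apply He, Hy. }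
      exists N; intros n Hn; rewrite ER; now apply HN.
    + destruct (H (fun y : C => P (Im y))) as [N HN].
      { exists e; intros y [_ Hy]; apply He, Hy. }
      exists N; intros n Hn; rewrite EI; now apply HN.
  - intros [H1 H2] P [e He].
    destruct (H1 (ball (Re l) e)) as [N1 HN1]; [now exists e|].
    destruct (H2 (ball (Im l) e)) as [N2 HN2]; [now exists e|].
    exists (max N1 N2); intros n Hn; apply He; split.
    + change (ball (Re l) e (Re (sum_n (G := C_R_NormedModule) u n))).
      rewrite <- ER; apply HN1; lia.
    + change (ball (Im l) e (Im (sum_n (G := C_R_NormedModule) u n))).
      rewrite <- EI; apply HN2; lia.
Qed.

Lemma ex_Cseries_comp (u : nat -> C) :
  ex_Cseries u <-> ex_series (fun n => Re (u n)) /\ ex_series (fun n => Im (u n)).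
Proof.
  split.
  - intros [l H]; apply is_Cseries_comp in H; destruct H as [H1 H2].
    split; eexists; eassumption.
  - intros [[x H1] [y H2]]; exists (x, y); now apply is_Cseries_comp.
Qed.

Lemma CSeries_correct (u : nat -> C) :
  ex_Cseries u -> is_series (V := C_NormedModule) u (CSeries u).
Proof.
  intros [l H]; rewrite (CSeries_unique _ _ H); exact H.
Qed.

Lemma CSeries_ext (u v : nat -> C) : (forall n, u n = v n) -> CSeries u = CSeries v.
Proof.
  intros H; unfold CSeries; f_equal; apply Series_ext; intros n; now rewrite H.
Qed.

Lemma ex_Cseries_ext (u v : nat -> C) :
  (forall n, u n = v n) -> ex_Cseries u -> ex_Cseries v.
Proof. exact (ex_series_ext (V := C_R_NormedModule) u v). Qed.

Lemma is_Cseries_scal (c : C) (u : nat -> C) :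
  ex_Cseries u ->
  is_series (V := C_NormedModule) (fun n => c * u n) (c * CSeries u).
Proof.
  intros H; apply (is_series_scal (V := C_NormedModule) c), CSeries_correct, H.
Qed.

Lemma ex_Cseries_scal (c : C) (u : nat -> C) :
  ex_Cseries u -> ex_Cseries (fun n => c * u n).
Proof. intros H; eexists; apply (is_Cseries_scal c u H). Qed.

Lemma CSeries_scal (c : C) (u : nat -> C) :
  ex_Cseries u -> CSeries (fun n => c * u n) = c * CSeries u.
Proof. intros H; apply CSeries_unique, (is_Cseries_scal c u H). Qed.

Lemma CSeries_minus (u v : nat -> C) :
  ex_Cseries u -> ex_Cseries v ->
  CSeries (fun n => u n - v n) = CSeries u - CSeries v.
Proof.
  intros Hu Hv; apply CSeries_unique.
  exact (is_series_minus (V := C_NormedModule) u v _ _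
           (CSeries_correct u Hu) (CSeries_correct v Hv)).
Qed.

Lemma CSeries_incr_1 (u : nat -> C) :
  ex_Cseries u -> CSeries u = u O + CSeries (fun n => u (S n)).
Proof.
  intros H; apply ex_Cseries_comp in H; destruct H as [H1 H2].
  unfold CSeries; rewrite (Series_incr_1 _ H1), (Series_incr_1 _ H2).
  destruct (u O); reflexivity.
Qed.

Lemma im_le_Cmod (c : C) : (Rabs (Im c) <= Cmod c)%R.
Proof. eapply Rle_trans; [apply Rmax_r | apply Rmax_Cmod]. Qed.

Lemma Cmod_le_comp (c : C) : (Cmod c <= Rabs (Re c) + Rabs (Im c))%R.
Proof.
  unfold Cmod; destruct c as [x y]; simpl Re; simpl Im; simpl fst; simpl snd.
  rewrite <- (Rabs_pos_eq (Rabs x + Rabs y)) by (generalize (Rabs_pos x) (Rabs_pos y); lra).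
  rewrite <- sqrt_Rsqr_abs; apply sqrt_le_1_alt; unfold Rsqr.
  generalize (Rabs_pos x) (Rabs_pos y) (pow2_abs x) (pow2_abs y); intros; nra.
Qed.

Lemma ex_Cseries_le (u : nat -> C) (v : nat -> R) :
  (forall n, (Cmod (u n) <= v n)%R) -> ex_series v -> ex_Cseries u.
Proof.
  intros H Hv; apply ex_Cseries_comp; split; apply ex_series_Rabs_le with (2 := Hv);
    intros n; eapply Rle_trans; [apply re_le_Cmod | apply H | apply im_le_Cmod | apply H].
Qed.

(** The factor 2 comes from bounding the two components separately. *)
Lemma Cmod_CSeries_le (u : nat -> C) (v : nat -> R) :
  (forall n, (Cmod (u n) <= v n)%R) -> ex_series v ->
  (Cmod (CSeries u) <= 2 * Series v)%R.
Proof.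
  intros H Hv; eapply Rle_trans; [apply Cmod_le_comp|].
  assert (Rabs (Re (CSeries u)) <= Series v)%R.
  { apply Rabs_Series_le; [|easy]; intros n.
    eapply Rle_trans; [apply re_le_Cmod | apply H]. }
  assert (Rabs (Im (CSeries u)) <= Series v)%R.
  { apply Rabs_Series_le; [|easy]; intros n.
    eapply Rle_trans; [apply im_le_Cmod | apply H]. }
  lra.
Qed.

Lemma ex_Cseries_lim_0 (u : nat -> C) :
  ex_Cseries u -> is_lim_seq (fun n => Cmod (u n)) 0.
Proof.
  intros H; apply ex_Cseries_comp in H; destruct H as [H1 H2].
  apply ex_series_lim_0 in H1; apply ex_series_lim_0 in H2.
  apply is_lim_seq_abs in H1; apply is_lim_seq_abs in H2.
  apply is_lim_seq_le_le with (fun _ => 0%R) (fun n => (Rabs (Re (u n)) + Rabs (Im (u n)))%R).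
  - intros n; split; [apply Cmod_ge_0 | apply Cmod_le_comp].
  - apply is_lim_seq_const.
  - replace (Finite 0) with (Finite (Rabs 0 + Rabs 0)) by (rewrite Rabs_R0; f_equal; ring).
    now apply is_lim_seq_plus'.
Qed.

Lemma CSeries_exchange (F : nat -> nat -> C) (x y : nat -> R) :
  (forall n l, (Cmod (F n l) <= x n * y l)%R) -> ex_series x -> ex_series y ->
  ex_Cseries (fun n => CSeries (F n)) /\
  CSeries (fun n => CSeries (F n)) = CSeries (fun l => CSeries (fun n => F n l)).
Proof.
  intros HF Hx Hy.
  destruct (Series_exchange (fun n l => Re (F n l)) x y) as [R1 R2]; try easy.
  { intros n l; eapply Rle_trans; [apply re_le_Cmod | apply HF]. }
  destruct (Series_exchange (fun n l => Im (F n l)) x y) as [I1 I2]; try easy.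
  { intros n l; eapply Rle_trans; [apply im_le_Cmod | apply HF]. }
  split; [now apply ex_Cseries_comp|].
  unfold CSeries at 1 3; f_equal; symmetry; now apply is_series_unique.
Qed.

Lemma C_lim_seq_Cmod (u : nat -> C) (l : C) :
  is_lim_seq (fun n => Cmod (u n - l)) 0 -> C_lim_seq u = l.
Proof.
  intros H; apply C_lim_seq_unique; intros P [e He].
  apply is_lim_seq_spec in H; destruct (H e) as [N HN].
  exists N; intros n Hn; apply He.
  apply C_NormedModule_mixin_compat1.
  specialize (HN n Hn); rewrite Rminus_0_r, Rabs_pos_eq in HN by apply Cmod_ge_0.
  exact HN.
Qed.

(** * Bounds for q-shifted factorials *)

Lemma Cmod_one_minus_le (x : C) : (Cmod (1 - x) <= 1 + Cmod x)%R.
Proof.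
  eapply Rle_trans; [apply Cmod_triangle|]; rewrite Cmod_opp, Cmod_1; lra.
Qed.

Lemma Cmod_one_minus_ge (x : C) : (1 - Cmod x <= Cmod (1 - x))%R.
Proof.
  generalize (Cmod_triangle (1 - x) x).
  replace (1 - x + x) with (RtoC 1) by ring; rewrite Cmod_1; lra.
Qed.

Lemma one_minus_neq_0 (x : C) : x <> 1 -> 1 - x <> 0.
Proof.
  intros H E; apply H.
  replace x with (1 - (1 - x)) by ring; rewrite E; ring.
Qed.

Lemma pow_lt_1 (t : R) (n : nat) : (0 <= t < 1 -> 0 <= t ^ n <= 1)%R.
Proof.
  intros H; split; [apply pow_le; lra|].
  rewrite <- (pow1 n); apply pow_incr; lra.
Qed.

Lemma qpoch_S (x q : C) (n : nat) : qpoch x q (S n) = qpoch x q n * (1 - x * q ^ n).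
Proof. reflexivity. Qed.

Lemma qpoch_shift (x q : C) (n : nat) :
  qpoch x q (S n) = (1 - x) * qpoch (x * q) q n.
Proof.
  induction n as [|n IH]; [unfold qpoch; simpl; ring|].
  rewrite qpoch_S, IH, qpoch_S, Cpow_S; ring.
Qed.

Lemma Cmod_lt_1_neq_1 (x : C) : (Cmod x < 1)%R -> x <> 1.
Proof. intros H ->; rewrite Cmod_1 in H; lra. Qed.

Section Modulus.

Context (q : C) (hq1 : (Cmod q < 1)%R).

Local Notation t := (Cmod q).

Lemma modulus_range : (0 <= t < 1)%R.
Proof. split; [apply Cmod_ge_0 | exact hq1]. Qed.

(** From [1 + u <= exp u] on each factor and the geometric series. *)
Lemma qpoch_upper (x : C) (n : nat) :
  (Cmod (qpoch x q n) <= exp (Cmod x / (1 - t)))%R.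
Proof.
  pose proof modulus_range as Ht.
  apply Rle_trans with (exp (Cmod x * ((1 - t ^ n) / (1 - t)))).
  - induction n as [|n IH].
    + unfold qpoch; simpl; rewrite Cmod_1.
      replace (Cmod x * ((1 - 1) / (1 - t)))%R with 0%R by (field; lra).
      rewrite exp_0; lra.
    + rewrite qpoch_S, Cmod_mult.
      replace (Cmod x * ((1 - t ^ S n) / (1 - t)))%R
        with (Cmod x * ((1 - t ^ n) / (1 - t)) + Cmod x * t ^ n)%R
        by (simpl; field; lra).
      rewrite exp_plus; apply Rmult_le_compat; try apply Cmod_ge_0; [exact IH|].
      eapply Rle_trans; [apply Cmod_one_minus_le|].
      rewrite Cmod_mult, Cmod_pow; apply exp_ineq1_le.
  - assert (H : (Cmod x * ((1 - t ^ n) / (1 - t)) <= Cmod x / (1 - t))%R).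
    { unfold Rdiv; apply Rmult_le_compat_l; [apply Cmod_ge_0|].
      rewrite <- (Rmult_1_l (/ (1 - t))) at 2.
      apply Rmult_le_compat_r; [apply Rlt_le, Rinv_0_lt_compat; lra|].
      generalize (pow_lt_1 t n Ht); lra. }
    destruct H as [H| ->]; [now apply Rlt_le, exp_increasing | lra].
Qed.

(** Weierstrass's inequality: the product of the [1 - u_i] is at least [1] minus
    the sum of the [u_i]. *)
Lemma qpoch_lower_small (x : C) (n : nat) :
  (Cmod x / (1 - t) <= / 2)%R -> (/ 2 <= Cmod (qpoch x q n))%R.
Proof.
  pose proof modulus_range as Ht; intros Hx.
  set (k := (Cmod x / (1 - t))%R) in *.
  assert (Ek : Cmod x = (k * (1 - t))%R) by (unfold k; field; lra).
  assert (Hk : (0 <= k)%R).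
  { apply Rdiv_le_0_compat; [apply Cmod_ge_0 | lra]. }
  enough (H : (1 - k * (1 - t ^ n) <= Cmod (qpoch x q n))%R).
  { generalize (pow_lt_1 t n Ht); intros; nra. }
  induction n as [|n IH].
  - unfold qpoch; simpl; rewrite Cmod_1; lra.
  - rewrite qpoch_S, Cmod_mult.
    pose proof (Cmod_one_minus_ge (x * q ^ n)) as H1.
    rewrite Cmod_mult, Cmod_pow, Ek in H1.
    pose proof (pow_lt_1 t n Ht) as Hn.
    change (t ^ S n)%R with (t * t ^ n)%R.
    set (v := (t ^ n)%R) in *; clearbody k v.
    apply Rle_trans with ((1 - k * (1 - v)) * (1 - k * (1 - t) * v))%R.
    + assert (0 <= (k * (1 - v)) * (k * ((1 - t) * v)))%R.
      { repeat apply Rmult_le_pos; lra. }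
      nra.
    + apply Rmult_le_compat; try lra; [nra|].
      assert (k * ((1 - t) * v) <= / 2 * 1)%R; [|lra].
      apply Rmult_le_compat; try lra; [apply Rmult_le_pos; lra | nra].
Qed.

(** Beyond some index the remaining factors fall under the small case; the
    finitely many earlier ones are nonzero. *)
Lemma qpoch_lower (x : C) :
  (forall i, x * q ^ i <> 1) ->
  exists c : R, (0 < c)%R /\ forall n, (c <= Cmod (qpoch x q n))%R.
Proof.
  pose proof modulus_range as Ht.
  enough (H : forall N (x : C), (Cmod x * t ^ N / (1 - t) <= / 2)%R ->
    (forall i, x * q ^ i <> 1) ->
    exists c : R, (0 < c)%R /\ forall n, (c <= Cmod (qpoch x q n))%R).
  { intros Hx.
    destruct (pow_lt_1_zero t (Rabs_def1 _ _ (proj2 Ht) ltac:(lra))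
      ((1 - t) / (2 * (Cmod x + 1)))%R) as [N HN].
    { generalize (Cmod_ge_0 x); intros; apply Rdiv_lt_0_compat; lra. }
    apply (H N); [|easy].
    specialize (HN N (Nat.le_refl N)).
    pose proof (pow_lt_1 t N Ht) as Hp; rewrite Rabs_pos_eq in HN by lra.
    generalize (Cmod_ge_0 x); intros H0.
    apply Rmult_lt_compat_l with (r := (2 * (Cmod x + 1))%R) in HN; [|lra].
    replace (2 * (Cmod x + 1) * ((1 - t) / (2 * (Cmod x + 1))))%R
      with (1 - t)%R in HN by (field; lra).
    apply Rmult_le_reg_r with (1 - t)%R; [lra|].
    unfold Rdiv; rewrite Rmult_assoc, Rinv_l by lra; nra. }
  clear x; induction N as [|N IH]; intros x HN Hx.
  - exists (/ 2)%R; split; [lra|]; intros n; apply qpoch_lower_small.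
    simpl in HN; now rewrite Rmult_1_r in HN.
  - destruct (IH (x * q)) as [c [Hc H]].
    + rewrite Cmod_mult.
      replace (Cmod x * t * t ^ N)%R with (Cmod x * t ^ S N)%R by (simpl; ring); easy.
    + intros i; specialize (Hx (S i)); rewrite Cpow_S in Hx.
      now replace (x * q * q ^ i) with (x * (q * q ^ i)) by ring.
    + assert (H1 : (0 < Cmod (1 - x))%R).
      { apply Cmod_gt_0, one_minus_neq_0.
        specialize (Hx O); simpl in Hx; now rewrite Cmult_1_r in Hx. }
      exists (Rmin 1 (Cmod (1 - x) * c)); split.
      * apply Rmin_glb_lt; [lra|]; now apply Rmult_lt_0_compat.
      * intros [|n]; [unfold qpoch; simpl; rewrite Cmod_1; apply Rmin_l|].
        rewrite qpoch_shift, Cmod_mult; eapply Rle_trans; [apply Rmin_r|].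
        apply Rmult_le_compat_l; [lra | apply H].
Qed.

Lemma Cmod_pow_lt_1 (x : C) (i : nat) : (Cmod x < 1)%R -> (Cmod (x * q ^ i) < 1)%R.
Proof.
  intros Hx; rewrite Cmod_mult, Cmod_pow.
  pose proof (pow_lt_1 t i modulus_range); pose proof (Cmod_ge_0 x); nra.
Qed.

Lemma qpoch_q_lower : exists c : R, (0 < c)%R /\ forall n, (c <= Cmod (qpoch q q n))%R.
Proof.
  apply qpoch_lower; intros i; now apply Cmod_lt_1_neq_1, Cmod_pow_lt_1.
Qed.

Lemma qpoch_q_neq_0 (n : nat) : qpoch q q n <> 0.
Proof.
  destruct qpoch_q_lower as [c [Hc H]]; apply Cmod_gt_0; specialize (H n); lra.
Qed.

(** * Euler's series for the reciprocal of the infinite product *)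

Definition euler_term (x : C) (n : nat) : C := x ^ n / qpoch q q n.

Definition euler (x : C) : C := CSeries (euler_term x).

Lemma euler_term_le : exists M : R, forall (x : C) (n : nat),
  (Cmod (euler_term x n) <= M * Cmod x ^ n)%R.
Proof.
  destruct qpoch_q_lower as [c [Hc H]]; exists (/ c)%R; intros x n.
  unfold euler_term; rewrite Cmod_div, Cmod_pow by apply qpoch_q_neq_0.
  unfold Rdiv; rewrite Rmult_comm; apply Rmult_le_compat_r; [apply pow_le, Cmod_ge_0|].
  apply Rinv_le_contravar; [easy | apply H].
Qed.

Lemma ex_series_geom_scal (M y : R) :
  (0 <= y < 1)%R -> ex_series (fun n => M * y ^ n)%R.
Proof.
  intros Hy; apply (ex_series_scal (V := R_NormedModule) M).
  exists (/ (1 - y))%R; apply is_series_geom; rewrite Rabs_pos_eq; lra.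
Qed.

Lemma ex_euler (x : C) : (Cmod x < 1)%R -> ex_Cseries (euler_term x).
Proof.
  intros Hx; destruct euler_term_le as [M HM].
  apply ex_Cseries_le with (1 := HM x), ex_series_geom_scal.
  split; [apply Cmod_ge_0 | easy].
Qed.

Lemma euler_shift (x : C) : (Cmod x < 1)%R -> euler (x * q) = (1 - x) * euler x.
Proof.
  intros Hx.
  assert (Hxq : (Cmod (x * q) < 1)%R).
  { replace q with (q ^ 1) by (simpl; ring); now apply Cmod_pow_lt_1. }
  enough (E : euler x - euler (x * q) = x * euler x).
  { replace (euler (x * q)) with (euler x - (euler x - euler (x * q))) by ring.
    rewrite E; ring. }
  unfold euler; rewrite <- CSeries_minus, <- CSeries_scal by now apply ex_euler.
  rewrite CSeries_incr_1.
  - replace (euler_term x O - euler_term (x * q) O) with (RtoC 0)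
      by (unfold euler_term; simpl; ring).
    rewrite Cplus_0_l; apply CSeries_ext; intros n; unfold euler_term.
    pose proof (qpoch_q_neq_0 (S n)) as H; pose proof (qpoch_q_neq_0 n) as H0.
    rewrite qpoch_S in H |- *; rewrite Cpow_mult_l, !Cpow_S.
    field; split; [easy|]; intros E; apply H; rewrite E; ring.
  - destruct (ex_euler x Hx) as [l1 H1], (ex_euler _ Hxq) as [l2 H2].
    exact (ex_intro _ _ (is_series_minus (V := C_R_NormedModule) _ _ _ _ H1 H2)).
Qed.

Lemma qpoch_mul_euler (x : C) (N : nat) :
  (Cmod x < 1)%R -> qpoch x q N * euler x = euler (x * q ^ N).
Proof.
  intros Hx; induction N as [|N IH].
  - unfold qpoch; simpl; rewrite Cmult_1_r; ring.
  - rewrite Cpow_S; replace (x * (q * q ^ N)) with (x * q ^ N * q) by ring.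
    rewrite euler_shift by now apply Cmod_pow_lt_1.
    rewrite <- IH, qpoch_S; ring.
Qed.

Lemma euler_lim (x : C) :
  (Cmod x < 1)%R -> is_lim_seq (fun N => Cmod (euler (x * q ^ N) - 1)) 0.
Proof.
  intros Hx; destruct euler_term_le as [M HM].
  pose proof modulus_range as Ht; pose proof (Cmod_ge_0 x) as H0.
  assert (HM0 : (0 <= M)%R).
  { specialize (HM 0 O); simpl in HM; rewrite Rmult_1_r in HM.
    eapply Rle_trans; [apply Cmod_ge_0 | exact HM]. }
  set (K := (2 * Series (fun n => M * Cmod x ^ n))%R).
  apply is_lim_seq_le_le with (fun _ => 0%R) (fun N => (K * t ^ N)%R).
  - intros N; split; [apply Cmod_ge_0|].
    unfold euler; rewrite CSeries_incr_1 by now apply ex_euler, Cmod_pow_lt_1.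
    set (S := CSeries _).
    replace (euler_term (x * q ^ N) 0 + S - 1) with S
      by (unfold euler_term, qpoch; simpl; field).
    unfold S; clear S.
    unfold K; rewrite Rmult_assoc, <- Series_scal_r; apply Cmod_CSeries_le.
    + intros n; eapply Rle_trans; [apply HM|].
      rewrite Cmod_mult, Cmod_pow.
      rewrite Rmult_assoc; apply Rmult_le_compat_l; [easy|].
      rewrite Rpow_mult_distr; simpl.
      pose proof (pow_lt_1 (Cmod x) n (conj H0 Hx)).
      pose proof (pow_lt_1 t N Ht) as Hv.
      assert (Hvn : (0 <= (t ^ N) ^ n <= 1)%R).
      { split; [apply pow_le; lra|]; rewrite <- (pow1 n); apply pow_incr; lra. }
      set (v := (t ^ N)%R) in *; set (vn := (v ^ n)%R) in *; set (xn := (Cmod x ^ n)%R) in *.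
      assert (Cmod x * xn <= xn)%R by nra.
      assert (v * vn <= v)%R by nra.
      apply Rmult_le_compat; try easy; apply Rmult_le_pos; lra.
    + apply ex_series_scal_r, ex_series_geom_scal; lra.
  - apply is_lim_seq_const.
  - replace (Finite 0) with (Finite (K * 0)) by (f_equal; ring).
    apply is_lim_seq_mult'; [apply is_lim_seq_const|].
    apply is_lim_seq_geom; rewrite Rabs_pos_eq; lra.
Qed.

(** The functional equation gives [qpoch x q N * euler x = euler (x * q ^ N)],
    which tends to [euler 0 = 1]; in particular [euler x] cannot vanish. *)
Lemma euler_neq_0 (x : C) : (Cmod x < 1)%R -> euler x <> 0.
Proof.
  intros Hx E; pose proof (euler_lim x Hx) as H.
  apply (is_lim_seq_ext _ (fun _ => 1%R)) in H.
  - apply is_lim_seq_unique in H; rewrite Lim_seq_const in H; injection H; lra.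
  - intros N; rewrite <- qpoch_mul_euler, E by easy.
    replace (qpoch x q N * 0 - 1) with (- (1)) by ring; apply Cmod_m1.
Qed.

Lemma qpoch_lim (x : C) :
  (Cmod x < 1)%R -> is_lim_seq (fun N => Cmod (qpoch x q N - / euler x)) 0.
Proof.
  intros Hx; pose proof (euler_neq_0 x Hx) as HE.
  apply (is_lim_seq_ext
    (fun N => (Cmod (/ euler x) * Cmod (euler (x * q ^ N) - 1))%R)).
  - intros N; rewrite <- Cmod_mult, <- qpoch_mul_euler by easy.
    f_equal; field; easy.
  - replace (Finite 0) with (Finite (Cmod (/ euler x) * 0)) by (f_equal; ring).
    apply is_lim_seq_mult'; [apply is_lim_seq_const | now apply euler_lim].
Qed.

Lemma qpoch_inf_euler (x : C) : (Cmod x < 1)%R -> qpoch_inf x q = / euler x.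
Proof. intros Hx; now apply C_lim_seq_Cmod, qpoch_lim. Qed.

Lemma qpoch_inf_neq_0 (x : C) : (Cmod x < 1)%R -> qpoch_inf x q <> 0.
Proof.
  intros Hx; rewrite qpoch_inf_euler by easy.
  intros E; apply C1_nz; rewrite <- (Cinv_l (euler x)) by now apply euler_neq_0.
  rewrite E; ring.
Qed.

Lemma qpoch_inf_upper (x : C) :
  (Cmod x < 1)%R -> (Cmod (qpoch_inf x q) <= exp (1 / (1 - t)))%R.
Proof.
  intros Hx; rewrite qpoch_inf_euler by easy.
  pose proof modulus_range as Ht.
  apply (is_lim_seq_le (fun _ => Cmod (/ euler x))
    (fun N => (exp (1 / (1 - t)) + Cmod (qpoch x q N - / euler x))%R)
    (Cmod (/ euler x)) (exp (1 / (1 - t)))).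
  - intros N.
    apply Rle_trans with (Cmod (qpoch x q N) + Cmod (qpoch x q N - / euler x))%R.
    + rewrite <- (Cmod_opp (qpoch x q N - / euler x)).
      eapply Rle_trans; [|apply Cmod_triangle]; right; f_equal; ring.
    + apply Rplus_le_compat_r; eapply Rle_trans; [apply qpoch_upper|].
      assert (H : (Cmod x / (1 - t) < 1 / (1 - t))%R).
      { unfold Rdiv; apply Rmult_lt_compat_r; [apply Rinv_0_lt_compat; lra | easy]. }
      now apply Rlt_le, exp_increasing.
  - apply is_lim_seq_const.
  - replace (Finite (exp (1 / (1 - t)))) with (Finite (exp (1 / (1 - t)) + 0))
      by (f_equal; ring).
    apply is_lim_seq_plus'; [apply is_lim_seq_const | now apply qpoch_lim].
Qed.

Lemma qpoch_inf_split (x : C) (n : nat) :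
  (Cmod x < 1)%R -> qpoch_inf x q = qpoch x q n * qpoch_inf (x * q ^ n) q.
Proof.
  intros Hx; pose proof (Cmod_pow_lt_1 x n Hx) as Hn.
  pose proof (euler_neq_0 x Hx) as H1; pose proof (euler_neq_0 _ Hn) as H2.
  rewrite !qpoch_inf_euler by easy.
  rewrite <- qpoch_mul_euler in H2 |- * by easy.
  field; split; [easy|]; intros E; apply H2; rewrite E; ring.
Qed.

(** This is the q-Laplace transform of a single power, with [x] equal to [q] to
    the exponent of the power plus one: Euler's series, term by term rewritten
    through [qpoch_inf_split] at [q]. *)
Lemma euler_tails (x : C) :
  (Cmod x < 1)%R ->
  CSeries (fun n => x ^ n * qpoch_inf (q * q ^ n) q) * qpoch_inf x q = qpoch_inf q q.
Proof.
  intros Hx.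
  rewrite (CSeries_ext _ (fun n => qpoch_inf q q * euler_term x n)).
  - rewrite CSeries_scal by now apply ex_euler.
    fold (euler x); rewrite (qpoch_inf_euler x Hx).
    field; now apply euler_neq_0.
  - intros n; rewrite (qpoch_inf_split q n hq1); unfold euler_term.
    field; apply qpoch_q_neq_0.
Qed.

End Modulus.

(** * Absolute convergence of the basic hypergeometric series *)

Lemma binom2_S (l : nat) : binom2 (S l) = (binom2 l + l)%nat.
Proof.
  unfold binom2; replace (S l * (S l - 1))%nat with (l * (l - 1) + l * 2)%nat
    by (destruct l; [reflexivity | simpl; rewrite Nat.sub_0_r; ring]).
  now rewrite Nat.div_add.
Qed.

Lemma ex_series_ratio (u : nat -> R) (L : nat) (rho : R) :
  (0 <= rho < 1)%R -> (forall n, (0 <= u n)%R) ->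
  (forall n, (L <= n)%nat -> (u (S n) <= rho * u n)%R) -> ex_series u.
Proof.
  intros Hr Hu H; apply (ex_series_incr_n u L).
  apply ex_series_Rabs_le with (fun k => (u L * rho ^ k)%R);
    [|now apply ex_series_geom_scal].
  intros k; rewrite Rabs_pos_eq by apply Hu.
  induction k as [|k IH]; [rewrite Nat.add_0_r; simpl; lra|].
  rewrite <- plus_n_Sm; eapply Rle_trans; [apply H; lia|]; simpl.
  replace (u L * (rho * rho ^ k))%R with (rho * (u L * rho ^ k))%R by ring.
  apply Rmult_le_compat_l; [lra | exact IH].
Qed.

(** The ratio of consecutive terms is [y * p ^ l]: it is either eventually
    bounded by some [rho < 1], or eventually at least [1], in which case the
    terms do not tend to [0]. *)
Lemma ex_series_theta (y p : R) :
  (0 <= y)%R -> (0 < p)%R ->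
  is_lim_seq (fun l => y ^ l * p ^ binom2 l)%R 0 ->
  ex_series (fun l => y ^ l * p ^ binom2 l)%R.
Proof.
  intros Hy Hp Hlim; set (u := fun l => (y ^ l * p ^ binom2 l)%R) in *.
  assert (Hu : forall l, (0 <= u l)%R).
  { intros l; apply Rmult_le_pos; apply pow_le; lra. }
  assert (HS : forall l, u (S l) = (y * p ^ l * u l)%R).
  { intros l; unfold u; rewrite binom2_S, pow_add; simpl; ring. }
  assert (Hbig : forall L, (0 < y)%R -> ~ forall l, (L <= l)%nat -> (1 <= y * p ^ l)%R).
  { intros L Hy0 H.
    assert (HL : (0 < u L)%R) by (apply Rmult_lt_0_compat; apply pow_lt; lra).
    assert (Hge : forall k, (u L <= u (L + k)%nat)%R).
    { induction k as [|k IH]; [rewrite Nat.add_0_r; lra|].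
      rewrite <- plus_n_Sm, HS; specialize (H (L + k)%nat ltac:(lia)).
      specialize (Hu (L + k)%nat); nra. }
    apply is_lim_seq_spec in Hlim; destruct (Hlim (mkposreal _ HL)) as [N HN].
    specialize (HN (L + N)%nat ltac:(lia)); specialize (Hge N); simpl in HN.
    rewrite Rminus_0_r, Rabs_pos_eq in HN by apply Hu; lra. }
  destruct (Rle_lt_or_eq_dec 0 y Hy) as [Hy0|<-].
  2: { apply ex_series_ratio with (L := O) (rho := 0%R); [lra | easy|].
       intros n _; rewrite HS; lra. }
  destruct (Rtotal_order p 1) as [Hp1|[->|Hp1]].
  - destruct (pow_lt_1_zero p (Rabs_def1 _ _ Hp1 ltac:(lra)) (/ (2 * y))) as [L HL].
    { apply Rinv_0_lt_compat; lra. }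
    apply ex_series_ratio with (L := L) (rho := (/ 2)%R); [lra | easy|].
    intros n Hn; specialize (HL n ltac:(lia)); rewrite HS.
    apply Rmult_le_compat_r; [easy|].
    rewrite Rabs_pos_eq in HL by (apply pow_le; lra).
    apply Rmult_lt_compat_l with (r := y) in HL; [|easy].
    replace (y * / (2 * y))%R with (/ 2)%R in HL by (field; lra); lra.
  - destruct (Rlt_le_dec y 1) as [Hy1|Hy1].
    + apply ex_series_ratio with (L := O) (rho := y); [lra | easy|].
      intros n _; rewrite HS, pow1; lra.
    + exfalso; apply (Hbig O Hy0); intros l _; rewrite pow1; lra.
  - exfalso.
    destruct (Pow_x_infinity p ltac:(rewrite Rabs_pos_eq; lra) (/ y)) as [L HL].
    apply (Hbig L Hy0); intros l Hl; specialize (HL l Hl).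
    rewrite Rabs_pos_eq in HL by (apply pow_le; lra).
    apply Rge_le, Rmult_le_compat_l with (r := y) in HL; [|lra].
    rewrite Rinv_r in HL; lra.
Qed.

(** Reduces identities between integer powers to natural powers; the exponent
    does not depend on the base, so two powers can be treated at once. *)
Lemma Cpowz_cases (e : Z) : exists k : nat,
  (e = Z.of_nat k /\ forall z, Cpowz z e = z ^ k) \/
  (e = (- Z.of_nat k)%Z /\ forall z, Cpowz z e = / z ^ k).
Proof.
  destruct e as [|p|p].
  - exists O; left; split; [reflexivity|]; intros z; reflexivity.
  - exists (Pos.to_nat p); left; split; [lia|]; intros z; reflexivity.
  - exists (Pos.to_nat p); right; split; [lia|]; intros z; reflexivity.
Qed.

Lemma Cpowz_nat (z : C) (k : nat) : Cpowz z (Z.of_nat k) = z ^ k.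
Proof.
  destruct k as [|k]; [reflexivity|]; simpl Z.of_nat; unfold Cpowz.
  now rewrite SuccNat2Pos.id_succ.
Qed.

Lemma Cpowz_opp_nat (z : C) (k : nat) : Cpowz z (- Z.of_nat k) = / z ^ k.
Proof.
  destruct k as [|k]; [simpl; now rewrite <- (Cinv_l 1), Cmult_1_r at 1 by apply C1_nz|].
  simpl Z.of_nat; unfold Cpowz; simpl Z.opp; cbv iota.
  now rewrite SuccNat2Pos.id_succ.
Qed.

Lemma Cpowz_mul_nat (z : C) (e : Z) (m : nat) :
  z <> 0 -> Cpowz z (e * Z.of_nat m) = Cpowz z e ^ m.
Proof.
  intros Hz; destruct (Cpowz_cases e) as [k [[-> H]|[-> H]]]; rewrite H.
  - now rewrite <- Nat2Z.inj_mul, Cpowz_nat, Cpow_mult_r.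
  - rewrite Z.mul_opp_l, <- Nat2Z.inj_mul, Cpowz_opp_nat, Cpow_mult_r.
    now rewrite Cpow_inv by now apply Cpow_nz.
Qed.

Lemma Cpowz_pow (z : C) (e : Z) (m : nat) :
  z <> 0 -> Cpowz (z ^ m) e = Cpowz z e ^ m.
Proof.
  intros Hz; destruct (Cpowz_cases e) as [k [[_ H]|[_ H]]]; rewrite !H;
    rewrite <- !Cpow_mult_r, ?(Nat.mul_comm m k), ?Cpow_mult_r; [easy|].
  now rewrite Cpow_inv by now apply Cpow_nz.
Qed.

Lemma Cpowz_mul (x y : C) (e : Z) :
  x <> 0 -> y <> 0 -> Cpowz (x * y) e = Cpowz x e * Cpowz y e.
Proof.
  intros Hx Hy; destruct (Cpowz_cases e) as [k [[_ H]|[_ H]]]; rewrite !H, Cpow_mult_l.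
  - easy.
  - field; split; now apply Cpow_nz.
Qed.

Lemma Cpowz_neq_0 (z : C) (e : Z) : z <> 0 -> Cpowz z e <> 0.
Proof.
  intros Hz; destruct (Cpowz_cases e) as [k [[_ H]|[_ H]]]; rewrite H.
  - now apply Cpow_nz.
  - intros E; apply C1_nz; rewrite <- (Cinv_l (z ^ k)) by now apply Cpow_nz.
    rewrite E; ring.
Qed.

Lemma Cm1_neq_0 : RtoC (-1) <> 0.
Proof. apply Cmod_gt_0; rewrite Cmod_R, Rabs_left; lra. Qed.

Lemma Cmod_Cpowz_m1 (e : Z) : Cmod (Cpowz (-1) e) = 1%R.
Proof.
  assert (H1 : Cmod (-1) = 1%R).
  { rewrite Cmod_R, Rabs_left; lra. }
  pose proof Cm1_neq_0 as H0.
  destruct (Cpowz_cases e) as [k [[_ H]|[_ H]]]; rewrite H.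
  - now rewrite Cmod_pow, H1, pow1.
  - rewrite Cmod_inv by now apply Cpow_nz.
    rewrite Cmod_pow, H1, pow1; lra.
Qed.

Lemma sign_power (q : C) (e : Z) (l m : nat) :
  q <> 0 ->
  Cpowz ((-1) ^ l * q ^ m) e = Cpowz (-1) (e * Z.of_nat l) * Cpowz q (e * Z.of_nat m).
Proof.
  intros Hq; pose proof Cm1_neq_0 as H1.
  rewrite Cpowz_mul, !Cpowz_pow, !Cpowz_mul_nat; try easy; now apply Cpow_nz.
Qed.

Lemma Cprod_bounds (n : nat) (f : nat -> nat -> C) :
  (forall i, (i < n)%nat -> exists c M : R, (0 < c)%R /\
     forall l, (c <= Cmod (f i l) <= M)%R) ->
  exists c M : R, (0 < c)%R /\ forall l, (c <= Cmod (Cprod n (fun i => f i l)) <= M)%R.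
Proof.
  induction n as [|n IH]; intros H.
  - exists 1%R, 1%R; split; [lra|]; intros l; simpl; rewrite Cmod_1; lra.
  - destruct IH as [c [M [Hc HP]]]; [intros i Hi; apply H; lia|].
    destruct (H n ltac:(lia)) as [c' [M' [Hc' Hf]]].
    exists (c * c')%R, (M * M')%R; split; [nra|]; intros l; simpl.
    rewrite Cmod_mult; specialize (HP l); specialize (Hf l); split;
      apply Rmult_le_compat; lra.
Qed.

Lemma qpoch_bounds (q : C) (hq1 : (Cmod q < 1)%R) (x : C) :
  (forall i, x * q ^ i <> 1) ->
  exists c M : R, (0 < c)%R /\ forall n, (c <= Cmod (qpoch x q n) <= M)%R.
Proof.
  intros H; destruct (qpoch_lower q hq1 x H) as [c [Hc Hl]].
  exists c, (exp (Cmod x / (1 - Cmod q)))%R; split; [easy|].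
  intros n; split; [apply Hl | now apply qpoch_upper].
Qed.

Lemma Cmod_div_bounds (f g : nat -> C) :
  (exists c M : R, (0 < c)%R /\ forall l, (c <= Cmod (f l) <= M)%R) ->
  (exists c M : R, (0 < c)%R /\ forall l, (c <= Cmod (g l) <= M)%R) ->
  exists c M : R, (0 < c)%R /\ forall l, (c <= Cmod (f l / g l) <= M)%R.
Proof.
  intros [c [M [Hc Hf]]] [c' [M' [Hc' Hg]]].
  assert (HM' : (0 < M')%R) by (specialize (Hg O); lra).
  exists (c * / M')%R, (M * / c')%R; split.
  - apply Rmult_lt_0_compat; [easy | now apply Rinv_0_lt_compat].
  - intros l; specialize (Hf l); specialize (Hg l).
    rewrite Cmod_div by (apply Cmod_gt_0; lra).
    assert (0 < / M')%R by now apply Rinv_0_lt_compat.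
    assert (0 < / Cmod (g l))%R by (apply Rinv_0_lt_compat; lra).
    split; apply Rmult_le_compat; try lra; apply Rinv_le_contravar; lra.
Qed.

(** All q-shifted factorials stay between positive constants, so the terms are
    comparable to [|z| ^ l * p ^ binom2 l] with [p] the modulus of
    [q ^ (1 + s - r)]; for that sequence tending to [0] already forces
    summability. *)
Lemma basicPhi_abs (q : C) (r s : nat) (a b : nat -> C) (z : C) :
  (0 < Cmod q)%R -> (Cmod q < 1)%R ->
  (forall i l : nat, (i < r)%nat -> a i * q ^ l <> 1) ->
  (forall j l : nat, (j < s)%nat -> b j * q ^ l <> 1) ->
  ex_Cseries (basicPhi_term q r s a b z) ->
  ex_series (fun l => Cmod (basicPhi_term q r s a b z l)).
Proof.
  intros hq0 hq1 ha hb Hex.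
  assert (Hq : q <> 0) by now apply Cmod_gt_0.
  set (e := excess r s).
  set (p := Cmod (Cpowz q e)).
  assert (Hp : (0 < p)%R) by now apply Cmod_gt_0, Cpowz_neq_0.
  set (g := fun l => qpoch_ratio q r s a b l / qpoch q q l).
  assert (Hg : exists c M : R, (0 < c)%R /\ forall l, (c <= Cmod (g l) <= M)%R).
  { apply Cmod_div_bounds; [apply Cmod_div_bounds|].
    - apply (Cprod_bounds r (fun i l => qpoch (a i) q l)); intros i Hi.
      apply qpoch_bounds; [easy|]; intros l; now apply ha.
    - apply (Cprod_bounds s (fun j l => qpoch (b j) q l)); intros j Hj.
      apply qpoch_bounds; [easy|]; intros l; now apply hb.
    - apply qpoch_bounds; [easy|].
      intros i; now apply Cmod_lt_1_neq_1, Cmod_pow_lt_1. }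
  destruct Hg as [c [M [Hc Hg]]].
  assert (Ht : forall l, Cmod (basicPhi_term q r s a b z l) =
    (Cmod (g l) * (Cmod z ^ l * p ^ binom2 l))%R).
  { intros l; unfold basicPhi_term, p; rewrite sign_power, Cpowz_mul_nat with (z := q) by easy.
    fold e; rewrite <- !Cmod_pow.
    rewrite <- (Rmult_1_l (Cmod (z ^ l) * _)), <- (Cmod_Cpowz_m1 (e * Z.of_nat l)).
    rewrite <- !Cmod_mult; f_equal; unfold g, Cdiv; ring. }
  assert (Hpos : forall l, (0 <= Cmod z ^ l * p ^ binom2 l)%R).
  { intros l; apply Rmult_le_pos; apply pow_le; [apply Cmod_ge_0 | lra]. }
  apply ex_series_Rabs_le with (fun l => (M * (Cmod z ^ l * p ^ binom2 l))%R).
  - intros l; rewrite Rabs_pos_eq by apply Cmod_ge_0.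
    rewrite Ht; apply Rmult_le_compat_r; [apply Hpos | apply Hg].
  - apply (ex_series_scal (V := R_NormedModule) M), ex_series_theta;
      [apply Cmod_ge_0 | easy|].
    apply ex_Cseries_lim_0 in Hex.
    apply is_lim_seq_le_le with (fun _ => 0%R)
      (fun l => (/ c * Cmod (basicPhi_term q r s a b z l))%R).
    + intros l; split; [apply Hpos|].
      rewrite Ht, <- Rmult_assoc.
      rewrite <- (Rmult_1_l (Cmod z ^ l * _)) at 1.
      apply Rmult_le_compat_r; [apply Hpos|].
      rewrite <- (Rinv_l c) by lra.
      apply Rmult_le_compat_l; [apply Rlt_le, Rinv_0_lt_compat; lra | apply Hg].
    + apply is_lim_seq_const.
    + replace (Finite 0) with (Finite (/ c * 0)) by (f_equal; ring).
      apply is_lim_seq_mult'; [apply is_lim_seq_const | easy].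
Qed.

(** * Complex powers and the q-Gamma factor *)

Lemma Cexp_add (x y : C) : Cexp (x + y) = Cexp x * Cexp y.
Proof.
  destruct x as [x1 x2], y as [y1 y2]; unfold Cexp, Cmult; simpl.
  rewrite exp_plus, cos_plus, sin_plus; f_equal; ring.
Qed.

Lemma Cexp_0 : Cexp 0 = 1.
Proof.
  unfold Cexp; simpl; rewrite exp_0, cos_0, sin_0; unfold RtoC; f_equal; ring.
Qed.

Lemma Cexp_neq_0 (x : C) : Cexp x <> 0.
Proof.
  intros E; apply C1_nz; rewrite <- Cexp_0.
  replace (RtoC 0) with (x + - x) by ring; rewrite Cexp_add, E; ring.
Qed.

Lemma Cexp_opp (x : C) : Cexp (- x) = / Cexp x.
Proof.
  pose proof (Cexp_neq_0 x) as H.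
  assert (E : Cexp x * Cexp (- x) = 1).
  { rewrite <- Cexp_add, <- Cexp_0; f_equal; ring. }
  replace (Cexp (- x)) with (/ Cexp x * (Cexp x * Cexp (- x))) by (field; easy).
  rewrite E; ring.
Qed.

Lemma Cexp_nat (n : nat) (x : C) : Cexp (INR n * x) = Cexp x ^ n.
Proof.
  induction n as [|n IH]; [simpl; rewrite <- Cexp_0; f_equal; ring|].
  rewrite S_INR, RtoC_plus, Cpow_S, <- IH, <- Cexp_add; f_equal; ring.
Qed.

(** The poles of the q-Gamma function have [|q ^ x| >= 1]. *)
Lemma inv_qGamma_eq (q : C) (hq1 : (Cmod q < 1)%R) (lq l1q x : C) :
  (Cmod (cpower lq x) < 1)%R ->
  inv_qGamma q lq l1q x =
  qpoch_inf (cpower lq x) q / qpoch_inf q q * cpower l1q (x - 1).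
Proof.
  intros Hx; unfold inv_qGamma, qGamma.
  pose proof (qpoch_inf_neq_0 q hq1 _ Hx) as H1.
  pose proof (qpoch_inf_neq_0 q hq1 q hq1) as H2.
  destruct (Ceq_dec _ _) as [E|_]; [easy|].
  replace (cpower l1q (x - 1)) with (/ cpower l1q (1 - x)).
  - field; repeat split; try easy; apply Cexp_neq_0.
  - unfold cpower; rewrite <- Cexp_opp; f_equal; ring.
Qed.

(** At the grid point [q ^ n / w] the powers of [w], [1 - q] and [q] in the
    term of R regroup into the term of Phi, up to a factor depending on [l]
    through [q ^ (l * alpha)] only. *)
Lemma basicR_term_grid (q : C) (hq0 : (0 < Cmod q)%R) (hq1 : (Cmod q < 1)%R)
    (r s : nat) (a b : nat -> C) (alpha beta z lq l1q lw : C) (n l : nat) :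
  (Cmod (cpower lq alpha) <= 1)%R -> (Cmod (cpower lq beta) < 1)%R ->
  basicR_term q lq l1q r s a b alpha beta
    (z * cpower (INR n * lq - lw) alpha) l =
  cpower l1q (beta - 1)
  * (basicPhi_term q r s a b (z * cpower l1q alpha * cpower lw (- alpha)) l
     * (cpower lq alpha ^ l) ^ n
     * (qpoch_inf (cpower lq alpha ^ l * cpower lq beta) q / qpoch_inf q q)).
Proof.
  intros HA HB.
  assert (Hq : q <> 0) by now apply Cmod_gt_0.
  assert (E : cpower lq (INR l * alpha + beta) = cpower lq alpha ^ l * cpower lq beta).
  { unfold cpower; rewrite <- Cexp_nat, <- Cexp_add; f_equal; ring. }
  assert (E1 : cpower l1q (INR l * alpha + beta - 1) =
               cpower l1q alpha ^ l * cpower l1q (beta - 1)).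
  { unfold cpower; rewrite <- Cexp_nat, <- Cexp_add; f_equal; ring. }
  assert (E2 : cpower (INR n * lq - lw) alpha = cpower lq alpha ^ n * cpower lw (- alpha)).
  { unfold cpower; rewrite <- Cexp_nat, <- Cexp_add; f_equal; ring. }
  unfold basicR_term; rewrite inv_qGamma_eq, E, E1, E2; [|easy|].
  - unfold basicPhi_term; rewrite sign_power by easy.
    rewrite <- !Cpow_mult_r, (Nat.mul_comm l n), !Cpow_mult_r, !Cpow_mult_l.
    unfold Cdiv; ring.
  - rewrite E, Cmod_mult, Cmod_pow.
    assert (H : (Cmod (cpower lq alpha) ^ l <= 1)%R).
    { rewrite <- (pow1 l); apply pow_incr; split; [apply Cmod_ge_0 | easy]. }
    pose proof (Cmod_ge_0 (cpower lq beta)); nra.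
Qed.

(** * Termwise transform *)

Theorem theorem12 :
  forall (q : C) (hq0 : (0 < Cmod q)%R) (hq1 : (Cmod q < 1)%R)
    (r s : nat) (hr : (0 < r)%nat) (hs : (0 < s)%nat)
    (a b : nat -> C) (alpha beta z w : C)
    (ha : forall i l : nat, (i < r)%nat -> a i * q ^ l <> 1)
    (hb : forall j l : nat, (j < s)%nat -> b j * q ^ l <> 1)
    (hw : w <> 0)
    (* the fixed branches *)
    (lq l1q lw : C) (logt : C -> C)
    (hlq : Cexp lq = q) (hl1q : Cexp l1q = 1 - q) (hlw : Cexp lw = w)
    (hlogt : compatible_branch q lq w lw logt)
    (* existence of the transforms of the powers t^(l alpha + beta - 1) *)
    (halpha : (Cmod (cpower lq alpha) <= 1)%R)
    (hbeta : (Cmod (cpower lq beta) < 1)%R)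
    (* existence of the right-hand side *)
    (hPhi : ex_Cseries (basicPhi_term q r s a b
              (z * cpower l1q alpha * cpower lw (- alpha)))),
  (forall n : nat,
     ex_Cseries (basicR_term q lq l1q r s a b alpha beta
       (z * cpower (logt (1 / w * q ^ n)) alpha))) /\
  ex_qLaplace q
    (fun t => cpower (logt t) (beta - 1)
              * basicR q lq l1q r s a b alpha beta (z * cpower (logt t) alpha)) w /\
  qLaplace q
    (fun t => cpower (logt t) (beta - 1)
              * basicR q lq l1q r s a b alpha beta (z * cpower (logt t) alpha)) w
  = cpower lw (- beta) * cpower l1q (beta - 1)
    * basicPhi q r s a b (z * cpower l1q alpha * cpower lw (- alpha)).
Proof.
  intros q hq0 hq1 r s hr hs a b alpha beta z w ha hb hw lq l1q lw logt
    hlq hl1q hlw [_ hgrid] halpha hbeta hPhi.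
  assert (H1q : 1 - q <> 0) by now apply one_minus_neq_0, Cmod_lt_1_neq_1.
  pose proof (basicPhi_abs _ _ _ _ _ _ hq0 hq1 ha hb hPhi) as Habs.
  set (Z := z * cpower l1q alpha * cpower lw (- alpha)) in *.
  set (T := basicPhi_term q r s a b Z) in *.
  set (A := cpower lq alpha) in *.
  set (B := cpower lq beta) in *.
  set (g := fun l => qpoch_inf (A ^ l * B) q / qpoch_inf q q).
  set (K := fun n => qpoch_inf (q * q ^ n) q).
  set (c1 := cpower l1q (beta - 1)).
  set (c2 := cpower lw (1 - beta)).
  (* Up to the constant [c1 * c2], row [n] is the Jackson term at [q ^ n / w] and
     column [l] is the transform of the [l]-th term of R. *)
  set (F := fun n l : nat => B ^ n * K n * (T l * (A ^ l) ^ n * g l)).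
  pose proof (qpoch_inf_neq_0 q hq1 q hq1) as HQ.
  assert (HA : forall l, (Cmod (A ^ l) <= 1)%R).
  { intros l; rewrite Cmod_pow, <- (pow1 l); apply pow_incr.
    split; [apply Cmod_ge_0 | easy]. }
  assert (HAB : forall l, (Cmod (A ^ l * B) < 1)%R).
  { intros l; rewrite Cmod_mult; specialize (HA l).
    pose proof (Cmod_ge_0 B); nra. }
  set (k0 := exp (1 / (1 - Cmod q))).
  assert (HK : forall n, (Cmod (K n) <= k0)%R).
  { intros n; now apply qpoch_inf_upper, Cmod_pow_lt_1. }
  set (k1 := (k0 * / Cmod (qpoch_inf q q))%R).
  assert (Hg : forall l, (Cmod (g l) <= k1)%R).
  { intros l; unfold g; rewrite Cmod_div by easy.
    apply Rmult_le_compat_r; [|now apply qpoch_inf_upper].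
    now apply Rlt_le, Rinv_0_lt_compat, Cmod_gt_0. }
  assert (HTg : forall n l, (Cmod (T l * (A ^ l) ^ n * g l) <= k1 * Cmod (T l))%R).
  { intros n l; rewrite !Cmod_mult.
    assert (H : (Cmod ((A ^ l) ^ n) <= 1)%R).
    { rewrite Cmod_pow, <- (pow1 n); apply pow_incr; split; [apply Cmod_ge_0 | apply HA]. }
    rewrite (Rmult_comm k1); apply Rmult_le_compat; try apply Cmod_ge_0; [| |apply Hg].
    - apply Rmult_le_pos; apply Cmod_ge_0.
    - rewrite <- (Rmult_1_r (Cmod (T l))) at 2.
      apply Rmult_le_compat_l; [apply Cmod_ge_0 | easy]. }
  assert (Hy : ex_series (fun l => k1 * Cmod (T l))%R).
  { now apply (ex_series_scal (V := R_NormedModule) k1). }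
  assert (Hrow : forall n, ex_Cseries (fun l => T l * (A ^ l) ^ n * g l)).
  { intros n; now apply ex_Cseries_le with (1 := HTg n). }
  assert (HR : forall n l, basicR_term q lq l1q r s a b alpha beta
      (z * cpower (logt (1 / w * q ^ n)) alpha) l = c1 * (T l * (A ^ l) ^ n * g l)).
  { intros n l; rewrite hgrid; now apply basicR_term_grid. }
  assert (Hj : forall n, jackson_term q (qLaplace_kernel q
      (fun t => cpower (logt t) (beta - 1)
        * basicR q lq l1q r s a b alpha beta (z * cpower (logt t) alpha)) w) (1 / w) n
      = c1 * c2 * CSeries (F n)).
  { intros n; unfold jackson_term, qLaplace_kernel, basicR.
    rewrite (CSeries_ext _ _ (HR n)), hgrid.
    unfold F; rewrite !CSeries_scal by apply Hrow.
    replace (q * w * (1 / w * q ^ n)) with (q * q ^ n) by (field; easy).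
    assert (E : q ^ n * cpower (INR n * lq - lw) (beta - 1) = B ^ n * c2).
    { unfold B, c2, cpower; rewrite <- hlq, <- !Cexp_nat, <- !Cexp_add.
      f_equal; ring. }
    fold (K n).
    match goal with |- _ * (_ * (_ * ?S)) = _ =>
      transitivity (q ^ n * cpower (INR n * lq - lw) (beta - 1) * (K n * S)); [ring|] end.
    rewrite E; ring. }
  destruct (CSeries_exchange F (fun n => k0 * Cmod B ^ n)%R (fun l => k1 * Cmod (T l))%R)
    as [Hex Hswap].
  { intros n l; unfold F; rewrite Cmod_mult.
    apply Rmult_le_compat; try apply Cmod_ge_0; [|apply HTg].
    rewrite Cmod_mult, Cmod_pow, (Rmult_comm k0).
    apply Rmult_le_compat_l; [apply pow_le, Cmod_ge_0 | apply HK]. }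
  { apply ex_series_geom_scal; split; [apply Cmod_ge_0 | easy]. }
  { exact Hy. }
  assert (Hcol : forall l, CSeries (fun n => F n l) = T l).
  { intros l.
    rewrite (CSeries_ext _ (fun n => T l * g l * ((A ^ l * B) ^ n * K n))).
    - rewrite CSeries_scal.
      + transitivity (T l * (CSeries (fun n => (A ^ l * B) ^ n * K n)
                             * qpoch_inf (A ^ l * B) q) / qpoch_inf q q).
        * unfold g; field; easy.
        * unfold K; rewrite euler_tails by (apply hq1 || apply HAB); field; easy.
      + apply ex_Cseries_le with (fun n => k0 * Cmod (A ^ l * B) ^ n)%R.
        * intros n; rewrite Cmod_mult, Cmod_pow, Rmult_comm.
          apply Rmult_le_compat_r; [apply pow_le, Cmod_ge_0 | apply HK].
        * apply ex_series_geom_scal; split; [apply Cmod_ge_0 | apply HAB].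
    - intros n; unfold F; rewrite Cpow_mult_l; ring. }
  split; [|split].
  - intros n; apply ex_Cseries_ext with (fun l => c1 * (T l * (A ^ l) ^ n * g l)).
    + intros l; symmetry; apply HR.
    + now apply ex_Cseries_scal.
  - apply ex_Cseries_ext with (fun n => c1 * c2 * CSeries (F n)).
    + intros n; symmetry; apply Hj.
    + now apply ex_Cseries_scal.
  - unfold qLaplace, jackson; rewrite (CSeries_ext _ _ Hj), CSeries_scal by easy.
    rewrite Hswap, (CSeries_ext _ _ Hcol).
    change (CSeries T) with (basicPhi q r s a b Z).
    assert (E : c2 = w * cpower lw (- beta)).
    { unfold c2, cpower; rewrite <- hlw, <- Cexp_add; f_equal; ring. }
    rewrite E; field; split; easy.
Qed.
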